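(* Let $\theta\in(0,\frac{1}{2+\sqrt2}]$ and $\rho\ge 1$. There is a constant $K>0$, depending only on $\theta$ and $\rho$ (in particular independent of $n$), such that the following holds for all $A\in\mathbb{R}^{m\times n}$, $b\in\mathbb{R}^m$, $c\in\mathbb{R}^n$, all initial points $(x^0,y^0,s^0)$ with $(x^0,s^0)\in\mathcal{N}(\theta)$ for which there is $(x^*,y^*,s^* )\in\mathcal{S}$ with $x^*\le\rho x^0$ and $s^*\le\rho s^0$ (componentwise), and every $\epsilon>0$. Let $(x^k,y^k,s^k)$ be generated by the arc-search algorithm described in the context. Then the algorithm terminates with a point $(x^k,y^k,s^k)$ satisfying $$\mu_k\le\epsilon,\qquad \|Ax^k-b\|\le\epsilon,\qquad \|A^{T}y^k+s^k-c\|\le\epsilon,\qquad (x^k,s^k)>0,$$ in at most $\mathcal{O}(nL)$ iterations, i.e. in at most $\lceil K\,n\,\max\{L,0\}\rceil$ iterations, where $$L=\max\left\{\ln\frac{(x^0)^{T}s^0}{\epsilon},\ \ln\frac{\|r_b^0\|}{\epsilon},\ \ln\frac{\|r_c^0\|}{\epsilon}\right\}$$ (with $\ln 0=-\infty$).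
   Context: Linear programming pair: (P) $\min c^{T}x$ subject to $Ax=b$, $x\ge0$; (D) $\max b^{T}y$ subject to $A^{T}y+s=c$, $s\ge0$, with $A\in\mathbb{R}^{m\times n}$, $b\in\mathbb{R}^m$, $c\in\mathbb{R}^n$. $\mathcal{S}$ is the set of optimal solutions $(x^*,y^*,s^* )$ of (P) and (D), i.e. of triples with $Ax^*=b$, $A^{T}y^*+s^*=c$, $x^*,s^*\ge0$, $x_i^*s_i^*=0$ for all $i$. Notation: $\circ$ is the componentwise product, $e$ the all-ones vector, $\|\cdot\|$ the Euclidean norm, vector inequalities are componentwise; $\mu=x^{T}s/n$ and $\mu_k=(x^k)^{T}s^k/n$; $r_b^k=Ax^k-b$, $r_c^k=A^{T}y^k+s^k-c$; $\mathcal{N}(\theta)=\{(x,s):(x,s)>0,\ \|x\circ s-\mu e\|\le\theta\mu\}$. Algorithm. Input: $A,b,c$, $\theta\in(0,\frac{1}{2+\sqrt2}]$, $\epsilon>0$, $(x^0,y^0,s^0)$ with $(x^0,s^0)\in\mathcal{N}(\theta)$. For $k=0,1,2,\dots$: Step 1: if $\mu_k\le\epsilon$, $\|r_b^k\|\le\epsilon$, $\|r_c^k\|\le\epsilon$ and $(x^k,s^k)>0$, stop. Step 2: solve for $(\dot x,\dot y,\dot s)$: $A\dot x=r_b^k$, $A^{T}\dot y+\dot s=r_c^k$, $s^k\circ\dot x+x^k\circ\dot s=x^k\circ s^k$; and for $(\ddot x,\ddot y,\ddot s)$: $A\ddot x=0$, $A^{T}\ddot y+\ddot s=0$, $s^k\circ\ddot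 x+x^k\circ\ddot s=-2\,\dot x\circ\dot s$. Step 3: with $(x(\alpha),y(\alpha),s(\alpha))=(x^k,y^k,s^k)-(\dot x,\dot y,\dot s)\sin\alpha+(\ddot x,\ddot y,\ddot s)(1-\cos\alpha)$, find the largest $\bar\alpha\in(0,\pi/2]$ such that for all $\alpha\in(0,\bar\alpha]$ one has $(x(\alpha),s(\alpha))>0$ and $\|x(\alpha)\circ s(\alpha)-(1-\sin\alpha)\mu_k e\|\le2\theta(1-\sin\alpha)\mu_k$. Set $\alpha=\bar\alpha$. Step 4: solve for $(\Delta x,\Delta y,\Delta s)$: $A\Delta x=0$, $A^{T}\Delta y+\Delta s=0$, $s(\alpha)\circ\Delta x+x(\alpha)\circ\Delta s=(1-\sin\alpha)\mu_k e-x(\alpha)\circ s(\alpha)$. Set $(x^{k+1},y^{k+1},s^{k+1})=(x(\alpha),y(\alpha),s(\alpha))+(\Delta x,\Delta y,\Delta s)$ and $\mu_{k+1}=(x^{k+1})^{T}s^{k+1}/n$. Standing assumption: at every iteration performed, the step $\bar\alpha$ of Step 3 exists and lies in $(0,\pi/2)$ (the case $\sin\alpha=1$, in which an optimal solution is found in one step, is excluded). *)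

(* Defs.v *)
From mathcomp Require Import all_boot all_order all_algebra.
From mathcomp Require Import all_classical all_reals all_analysis.

Set Implicit Arguments.
Unset Strict Implicit.
Unset Printing Implicit Defensive.

Import Order.TTheory GRing.Theory Num.Theory.
Local Open Scope ring_scope.

Section Vectors.
Context {R : realType} {n : nat}.
Implicit Types u v : 'cV[R]_n.

Definition dotv u v : R := (u^T *m v) 0 0.

(* The library's norm on matrices is the sup norm, hence this definition. *)
Definition norm2 u : R := Num.sqrt (dotv u u).

Definition mulv u v : 'cV[R]_n := map2_mx *%R u v.

Definition onev : 'cV[R]_n := const_mx 1.

Definition lev u v : Prop := forall i, u i 0 <= v i 0.

Definition posv u : Prop := forall i, 0 < u i 0.

Definition mu u v : R := dotv u v / n%:R.

End Vectors.

Section LinearProgram.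
Context {R : realType} {m n : nat}.

(* A triple (x, y, s); being a product of matrix spaces, it carries the
   componentwise vector-space operations used below. *)
Definition iterate : Type := ('cV[R]_n * 'cV[R]_m * 'cV[R]_n)%type.
Definition xof (z : iterate) : 'cV[R]_n := z.1.1.
Definition yof (z : iterate) : 'cV[R]_m := z.1.2.
Definition sof (z : iterate) : 'cV[R]_n := z.2.

Variables (A : 'M[R]_(m, n)) (b : 'cV[R]_m) (c : 'cV[R]_n).

Definition resb (z : iterate) : 'cV[R]_m := A *m xof z - b.
Definition resc (z : iterate) : 'cV[R]_n := A^T *m yof z + sof z - c.

Definition optimal (z : iterate) : Prop :=
  [/\ A *m xof z = b, A^T *m yof z + sof z = c,
      lev 0 (xof z), lev 0 (sof z)
    & forall i, xof z i 0 * sof z i 0 = 0].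

Definition positive_iterate (z : iterate) : Prop := posv (xof z) /\ posv (sof z).

Definition muz (z : iterate) : R := mu (xof z) (sof z).

Definition nbhd (theta : R) (x s : 'cV[R]_n) : Prop :=
  [/\ posv x, posv s
    & norm2 (mulv x s - mu x s *: onev) <= theta * mu x s].

Definition stop (eps : R) (z : iterate) : Prop :=
  [/\ muz z <= eps, norm2 (resb z) <= eps, norm2 (resc z) <= eps
    & positive_iterate z].

(* d solves A d_x = p, A^T d_y + d_s = q, s o d_x + x o d_s = r, where
   x and s are the components of z.  When A is rank deficient d_y need not be
   unique; any solution is allowed. *)
Definition newton (z : iterate) (p : 'cV[R]_m) (q r : 'cV[R]_n) (d : iterate) :
    Prop :=
  [/\ A *m xof d = p, A^T *m yof d + sof d = q
    & mulv (sof z) (xof d) + mulv (xof z) (sof d) = r].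

Definition arc_point (z z1 z2 : iterate) (alpha : R) : iterate :=
  z - sin alpha *: z1 + (1 - cos alpha) *: z2.

(* mu0 is the duality measure of the current iterate. *)
Definition arc_admissible (theta mu0 : R) (z : iterate) (alpha : R) : Prop :=
  positive_iterate z /\
  norm2 (mulv (xof z) (sof z) - ((1 - sin alpha) * mu0) *: onev)
    <= 2 * theta * (1 - sin alpha) * mu0.

Definition arc_step_ok (theta : R) (z z1 z2 : iterate) (abar : R) : Prop :=
  [/\ 0 < abar, abar <= pi / 2
    & forall alpha, 0 < alpha -> alpha <= abar ->
        arc_admissible theta (muz z) (arc_point z z1 z2 alpha) alpha].

Definition largest_arc_step (theta : R) (z z1 z2 : iterate) (abar : R) : Prop :=
  arc_step_ok theta z z1 z2 abar /\
  forall a, arc_step_ok theta z z1 z2 a -> a <= abar.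

(* One pass through Steps 2-4 from z, with step alpha and outcome z'. *)
Definition arc_iteration (theta : R) (z : iterate) (alpha : R) (z' : iterate) :
    Prop :=
  exists z1 z2 dz : iterate,
    let za := arc_point z z1 z2 alpha in
    [/\ newton z (resb z) (resc z) (mulv (xof z) (sof z)) z1,
        newton z 0 0 (- 2 *: mulv (xof z1) (sof z1)) z2,
        largest_arc_step theta z z1 z2 alpha,
        newton za 0 0
          (((1 - sin alpha) * muz z) *: onev - mulv (xof za) (sof za)) dz
      & z' = za + dz].

Section Runs.
Variables (theta eps : R) (z : nat -> iterate) (alpha : nat -> R).

Definition performed (k : nat) : Prop :=
  forall j, (j <= k)%N -> ~ stop eps (z j).

(* Iterates are constrained only up to the first one meeting the stopping
   test, so that terminating and nonterminating runs are both covered. *)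
Definition arc_search_run : Prop :=
  forall k, performed k -> arc_iteration theta (z k) (alpha k) (z k.+1).

Definition terminates_at (k : nat) : Prop :=
  stop eps (z k) /\ forall j, (j < k)%N -> ~ stop eps (z j).

End Runs.

(* lne sends 0 to -oo. *)
Definition logL (eps : R) (z0 : iterate) : \bar R :=
  maxe (lne (dotv (xof z0) (sof z0) / eps)%:E)
    (maxe (lne (norm2 (resb z0) / eps)%:E) (lne (norm2 (resc z0) / eps)%:E)).

End LinearProgram.

Arguments iterate : clear implicits.

(* Main.v *)
Require Import Defs.
From mathcomp Require Import all_boot all_order all_algebra.
From mathcomp Require Import all_classical all_reals all_analysis.
From mathcomp Require Import ring lra.

Import Order.TTheory GRing.Theory Num.Theory.
Local Open Scope ring_scope.

(** Write [t = sin alpha] for the step taken at an iterate [z].  The equations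
    of an iteration are linear and are designed so that both residuals and, once
    the corrector has been added, the duality measure get multiplied by exactly
    [1 - t].  Everything therefore reduces to a lower bound [t >= C / n] that
    holds at every iteration: after [k] iterations all three tested quantities
    have been multiplied by at most [(1 - C / n) ^ k <= exp (- C k / n)], which
    is at most [exp (- L)] as soon as [k >= n L / C].

    Iterates stay in the neighbourhood of radius [theta] ([corrector_nbhd]): the
    arc may widen the radius to [2 theta], and the corrector brings it back,
    because the two halves of its displacement are orthogonal, so that the
    componentwise product of these halves is quadratically small.  This is where
    [theta <= 1 / (2 + sqrt 2)] enters, in the form
    [sqrt 2 * theta <= 1 - 2 theta].

    The lower bound on [t] comes from measuring displacements in the scaling
    attached to [z], by means of [energy].  The first-order displacement solves
    the same equations as [nu (z0 - zs)] up to the complementarity row, where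
    [nu] is the reduction achieved so far and [zs] the given optimal solution;
    their difference is thus made of orthogonal halves and its energy is read
    off the right-hand side.  The domination of [zs] by [rho] times the starting
    point bounds the terms in [z0] and [zs] ([cross_dot_le]), and the energy is
    at most [Q ^ 2 mu] with [Q] a constant multiple of [n]
    ([predictor_energy_le]).  The second-order displacement is driven by the
    product of the halves of the first one, and its energy is at most
    [2 Q ^ 4 mu] ([second_order_energy_le]).  Along the arc the deviation from
    centrality other than the one inherited from [z] is at most [mu] times a
    polynomial in [t Q] without terms of degree less than three, so that every
    angle with [t Q <= theta / 4] is admissible ([arc_admissible_short]); being
    the largest admissible one, the step satisfies [t >= theta / (4 Q)]
    ([largest_arc_step_sin_ge]). *)

(** * Euclidean norm and sums of squares *)

Section Vectors.
Set Implicit Arguments.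
Unset Strict Implicit.
Context {R : realType} {n : nat}.
Implicit Types (u v : 'cV[R]_n) (f w t : 'I_n -> R).

Lemma dotvE u v : dotv u v = \sum_i u i 0 * v i 0.
Proof. by rewrite /dotv mxE; apply: eq_bigr => i _; rewrite mxE. Qed.

Lemma dotvv_ge0 u : 0 <= dotv u u.
Proof. by rewrite dotvE sumr_ge0 // => i _; rewrite -expr2 sqr_ge0. Qed.

Lemma norm2_ge0 u : 0 <= norm2 u. Proof. exact: sqrtr_ge0. Qed.

Lemma sqr_norm2 u : norm2 u ^+ 2 = dotv u u.
Proof. by rewrite sqr_sqrtr ?dotvv_ge0. Qed.

Lemma norm2_le u (a : R) : 0 <= a -> dotv u u <= a ^+ 2 -> norm2 u <= a.
Proof. by move=> a0 ua; rewrite -(ger0_norm a0) -sqrtr_sqr ler_wsqrtr. Qed.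

Lemma norm2Z (a : R) u : 0 <= a -> norm2 (a *: u) = a * norm2 u.
Proof.
move=> a0; rewrite /norm2 !dotvE -[in RHS](ger0_norm a0) -sqrtr_sqr.
rewrite -sqrtrM ?sqr_ge0 // mulr_sumr; congr Num.sqrt.
by apply: eq_bigr => i _; rewrite !mxE; ring.
Qed.

Lemma le_coord_norm2 u i : `|u i 0| <= norm2 u.
Proof.
rewrite -sqrtr_sqr ler_wsqrtr // dotvE (bigD1 i) //= -expr2 lerDl.
by rewrite sumr_ge0 // => j _; rewrite -expr2 sqr_ge0.
Qed.

Lemma centeringE u v (a : R) i :
  (mulv u v - a *: onev) i 0 = u i 0 * v i 0 - a.
Proof. by rewrite !mxE mulr1. Qed.

Lemma ler_sum_sqr f :
  (forall i, 0 <= f i) -> \sum_i f i ^+ 2 <= (\sum_i f i) ^+ 2.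
Proof.
move=> f0; rewrite expr2 mulr_suml; apply: ler_sum => i _; rewrite expr2.
by rewrite ler_wpM2l // (bigD1 i) //= lerDl sumr_ge0.
Qed.

(** A triangle inequality with the second norm weakened to the sum of absolute
    values, which is the form in which error terms get bounded; the inner
    product of the two vectors is then controlled coordinatewise. *)
Lemma norm2D_l1 u v : norm2 (u + v) <= norm2 u + \sum_i `|v i 0|.
Proof.
have v0 : 0 <= \sum_i `|v i 0| by exact: sumr_ge0.
apply: norm2_le; first by rewrite addr_ge0 ?norm2_ge0.
have uv : \sum_i u i 0 * v i 0 <= norm2 u * \sum_i `|v i 0|.
  rewrite mulr_sumr; apply: ler_sum => i _.
  by rewrite (le_trans (ler_norm _)) // normrM ler_wpM2r ?le_coord_norm2.
have vv : \sum_i v i 0 ^+ 2 <= (\sum_i `|v i 0|) ^+ 2.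
  apply: le_trans (ler_sum_sqr _) => //; apply: ler_sum => i _.
  by rewrite real_normK ?num_real.
have -> : dotv (u + v) (u + v) =
    norm2 u ^+ 2 + 2 * (\sum_i u i 0 * v i 0) + \sum_i v i 0 ^+ 2.
  rewrite sqr_norm2 !dotvE mulr_sumr -!big_split /=.
  by apply: eq_bigr => i _; rewrite !mxE; ring.
nra.
Qed.

(** The positive and the negative parts of [w] have the same sum, and that sum
    is at most the sum of [t]; each part contributes at most its square. *)
Lemma sum_sqr_skew w t :
    \sum_i w i = 0 -> (forall i, w i <= t i) -> (forall i, 0 <= t i) ->
  \sum_i w i ^+ 2 <= 2 * (\sum_i t i) ^+ 2.
Proof.
move=> w0 wt t0; pose p i := Num.max (w i) 0; pose q i := Num.max (- w i) 0.
have p0 i : 0 <= p i by rewrite le_max lexx orbT.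
have q0 i : 0 <= q i by rewrite le_max lexx orbT.
have wpq i : w i = p i - q i.
  by rewrite /p /q; case: (leP (w i) 0); case: (leP (- w i) 0); lra.
have w2pq i : w i ^+ 2 = p i ^+ 2 + q i ^+ 2.
  rewrite /p /q.
  by case: (leP (w i) 0); case: (leP (- w i) 0) => ? ?; try nra.
have pq : \sum_i p i = \sum_i q i.
  by apply/eqP; rewrite -subr_eq0 -sumrB -[eqbRHS]w0; apply/eqP/eq_bigr.
have pt : \sum_i p i <= \sum_i t i.
  by apply: ler_sum => i _; rewrite ge_max wt t0.
rewrite (eq_bigr _ (fun i _ => w2pq i)) big_split /=.
have := ler_sum_sqr p0; have := ler_sum_sqr q0; rewrite -pq.
have : 0 <= \sum_i p i by exact: sumr_ge0.
nra.
Qed.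

End Vectors.

(** * Scaled norms of Newton displacements *)

Section Newton.
Set Implicit Arguments.
Unset Strict Implicit.
Context {R : realType} {m n : nat}.
Implicit Types (A : 'M[R]_(m, n)) (z d e : iterate R m n) (r : 'cV[R]_n).

Lemma null_orthogonal A (u w : 'cV[R]_n) (y : 'cV[R]_m) :
  A *m u = 0 -> A^T *m y + w = 0 -> \sum_i u i 0 * w i 0 = 0.
Proof.
move=> Au /eqP; rewrite addrC addr_eq0 => /eqP ->.
rewrite -dotvE /dotv mulmxN mulmxA -trmx_mul Au trmx0 mul0mx.
by rewrite !mxE oppr0.
Qed.

Lemma newtonE A z p q r d i : newton A z p q r d ->
  sof z i 0 * xof d i 0 + xof z i 0 * sof d i 0 = r i 0.
Proof. by case=> _ _ <-; rewrite !mxE. Qed.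

Lemma newton_orthogonal A z r d : newton A z 0 0 r d ->
  \sum_i xof d i 0 * sof d i 0 = 0.
Proof. by case=> Au Aw _; exact: null_orthogonal Au Aw. Qed.

(** With [D] the diagonal matrix of entries [sqrt (x_i / s_i)], this is the sum
    of the squared Euclidean norms of [D^-1 d_x] and [D d_s]. *)
Definition energy z d : R :=
  \sum_i (xof d i 0 ^+ 2 * (sof z i 0 / xof z i 0) +
          sof d i 0 ^+ 2 * (xof z i 0 / sof z i 0)).

Lemma energy_term_ge0 z d i : positive_iterate z ->
  0 <= xof d i 0 ^+ 2 * (sof z i 0 / xof z i 0) /\
  0 <= sof d i 0 ^+ 2 * (xof z i 0 / sof z i 0).
Proof.
move=> [/(_ i) x0 /(_ i) s0].
by split; rewrite mulr_ge0 ?sqr_ge0 ?divr_ge0 ?ltW.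
Qed.

(** Dividing the square of the complementarity row [s_i u_i + x_i w_i = r_i] by
    [x_i s_i] gives the energy term plus [2 u_i w_i], and the latter sums to
    zero. *)
Lemma energy_newton A z r d : positive_iterate z -> newton A z 0 0 r d ->
  energy z d = \sum_i r i 0 ^+ 2 / (xof z i 0 * sof z i 0).
Proof.
move=> [x0 s0] nd; have := newton_orthogonal nd.
move=> /(congr1 (fun t => energy z d + 2 * t)); rewrite mulr0 addr0 => <-.
rewrite mulr_sumr -big_split /=; apply: eq_bigr => i _.
have := x0 i; have := s0 i; rewrite -(newtonE i nd).
move=> /lt0r_neq0 ? /lt0r_neq0 ?.
by field; apply/andP.
Qed.

Lemma sum_scaled_sqr_le (p r : 'I_n -> R) (g : R) :
    0 < g -> (forall i, g <= p i) ->
  \sum_i r i ^+ 2 / p i <= (\sum_i `|r i|) ^+ 2 / g.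
Proof.
move=> g0 gp; apply: (@le_trans _ _ ((\sum_i `|r i| ^+ 2) / g)).
  rewrite mulr_suml; apply: ler_sum => i _.
  rewrite real_normK ?num_real // ler_wpM2l ?sqr_ge0 // lef_pV2 ?posrE //.
  exact: lt_le_trans (gp i).
by rewrite ler_pM2r ?invr_gt0 //; exact: ler_sum_sqr.
Qed.

Lemma normM_le_weighted (k a b : R) : 0 < k ->
  `|a * b| <= (k * a ^+ 2 + k^-1 * b ^+ 2) / 2.
Proof.
move=> k0; rewrite normrM -(real_normK (num_real a)) -(real_normK (num_real b)).
have : 0 <= k^-1 * (k * `|a| - `|b|) ^+ 2.
  by rewrite mulr_ge0 ?sqr_ge0 // invr_ge0 ltW.
have -> : k^-1 * (k * `|a| - `|b|) ^+ 2 =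
    k * `|a| ^+ 2 + k^-1 * `|b| ^+ 2 - 2 * (`|a| * `|b|).
  by field; rewrite gt_eqF.
lra.
Qed.

(** The weight [l] balances displacements of different orders of magnitude;
    taking [e = d] and [l = 1] bounds the products within one displacement. *)
Lemma cross_products_le (l : R) z d e : positive_iterate z -> 0 < l ->
  \sum_i (`|xof d i 0 * sof e i 0| + `|xof e i 0 * sof d i 0|) <=
  (l * energy z d + l^-1 * energy z e) / 2.
Proof.
move=> [x0 s0] l0; rewrite !mulr_sumr -big_split /= mulr_suml.
apply: ler_sum => i _; have k0 : 0 < sof z i 0 / xof z i 0 by rewrite divr_gt0.
have := normM_le_weighted (xof d i 0) (sof e i 0) (mulr_gt0 l0 k0).
have l1 : 0 < l^-1 by rewrite invr_gt0.
have := normM_le_weighted (xof e i 0) (sof d i 0) (mulr_gt0 l1 k0).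
rewrite !invfM !invrK; lra.
Qed.

(** The new complementarity products are [mu' + dx_i ds_i], with [dx] and [ds]
    orthogonal, hence [mu'] is the new duality measure.  Orthogonality also
    makes the vector of these products small: each [dx_i ds_i] is at most
    [(x_i s_i - mu')^2 / (4 x_i s_i)], and [sum_sqr_skew] turns these one-sided
    bounds into a bound on the sum of squares. *)
Lemma corrector_nbhd A (theta mu' : R) z d :
    0 < theta -> 2 * theta < 1 -> 2 * theta ^+ 2 <= (1 - 2 * theta) ^+ 2 ->
    (0 < n)%N -> 0 < mu' -> positive_iterate z ->
    norm2 (mulv (xof z) (sof z) - mu' *: onev) <= 2 * theta * mu' ->
    newton A z 0 0 (mu' *: onev - mulv (xof z) (sof z)) d ->
  nbhd theta (xof (z + d)) (sof (z + d)) /\ muz (z + d) = mu'.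
Proof.
move=> th0 th1 th2 n0 mu0 z0 near nd.
have [x0 s0] := z0.
have xd i : xof (z + d) i 0 = xof z i 0 + xof d i 0 by rewrite /xof /= mxE.
have sd i : sof (z + d) i 0 = sof z i 0 + sof d i 0 by rewrite /sof /= mxE.
have nE i : sof z i 0 * xof d i 0 + xof z i 0 * sof d i 0
    = mu' - xof z i 0 * sof z i 0.
  by rewrite (newtonE i nd) !mxE mulr1.
have prodE i : xof (z + d) i 0 * sof (z + d) i 0
    = mu' + xof d i 0 * sof d i 0.
  by have := nE i; rewrite xd sd; lra.
have orth := newton_orthogonal nd.
have muE : muz (z + d) = mu'.
  rewrite /muz /mu dotvE (eq_bigr _ (fun i _ => prodE i)) big_split /= orth.
  rewrite addr0 sumr_const card_ord -[mu' *+ n]mulr_natr mulfK //.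
  by rewrite pnatr_eq0 -lt0n.
set g := (1 - 2 * theta) * mu'.
have h0 : 0 < 1 - 2 * theta by rewrite subr_gt0.
have g0 : 0 < g by exact: mulr_gt0.
have g4 : 0 < 4 * g by exact: mulr_gt0.
have gp i : g <= xof z i 0 * sof z i 0.
  have := le_trans (le_coord_norm2 _ i) near.
  by rewrite centeringE ler_norml => /andP[+ _]; rewrite /g; lra.
pose t i := (xof z i 0 * sof z i 0 - mu') ^+ 2 / (4 * g).
have t0 i : 0 <= t i by rewrite divr_ge0 ?sqr_ge0 // ltW.
have wt i : xof d i 0 * sof d i 0 <= t i.
  rewrite ler_pdivlMr //.
  have [w0|w0] := leP (xof d i 0 * sof d i 0) 0.
    by rewrite (@le_trans _ _ 0) ?sqr_ge0 // mulr_le0_ge0 // mulr_ge0 ?ltW.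
  apply: (@le_trans _ _ (xof d i 0 * sof d i 0 *
    (4 * (xof z i 0 * sof z i 0)))); first by rewrite ler_pM2l // ler_pM2l.
  have -> : (xof z i 0 * sof z i 0 - mu') ^+ 2 =
    (sof z i 0 * xof d i 0 + xof z i 0 * sof d i 0) ^+ 2 by rewrite nE; ring.
  rewrite -subr_ge0 (_ : _ - _ =
    (sof z i 0 * xof d i 0 - xof z i 0 * sof d i 0) ^+ 2) ?sqr_ge0 //; ring.
have w2 := sum_sqr_skew orth wt t0.
have tle : \sum_i t i <= (2 * theta * mu') ^+ 2 / (4 * g).
  rewrite -mulr_suml ler_pM2r ?invr_gt0 //.
  apply: (@le_trans _ _ (norm2 (mulv (xof z) (sof z) - mu' *: onev) ^+ 2)).
    rewrite sqr_norm2 dotvE le_eqVlt; apply/orP; left; apply/eqP.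
    by apply: eq_bigr => i _; rewrite centeringE -expr2.
  by rewrite ler_pXn2r ?nnegrE ?norm2_ge0 // !mulr_ge0 // ltW.
have tle' : 2 * (\sum_i t i) ^+ 2 <= (theta * mu') ^+ 2.
  have T0 : 0 <= \sum_i t i by exact: sumr_ge0.
  move: tle; rewrite ler_pdivlMr // /g => tle.
  have {}tle : (\sum_i t i) * (1 - 2 * theta) <= theta ^+ 2 * mu'.
    by rewrite -(ler_pM2r mu0); nra.
  rewrite -(ler_pM2r (exprn_gt0 2 h0)).
  have : ((\sum_i t i) * (1 - 2 * theta)) ^+ 2 <= (theta ^+ 2 * mu') ^+ 2.
    by rewrite ler_pXn2r ?nnegrE ?mulr_ge0 ?sqr_ge0 // ltW.
  have : 0 <= (theta * mu') ^+ 2 * ((1 - 2 * theta) ^+ 2 - 2 * theta ^+ 2).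
    by rewrite mulr_ge0 ?sqr_ge0 // subr_ge0.
  nra.
have near' : norm2 (mulv (xof (z + d)) (sof (z + d)) - mu' *: onev)
    <= theta * mu'.
  apply: norm2_le; first by rewrite mulr_ge0 ?ltW.
  apply: le_trans (le_trans w2 tle'); rewrite dotvE le_eqVlt.
  apply/orP; left; apply/eqP; apply: eq_bigr => i _.
  by rewrite centeringE prodE addrC addKr expr2.
have pos i : 0 < xof (z + d) i 0 * sof (z + d) i 0.
  have := le_trans (le_coord_norm2 _ i) near'.
  rewrite centeringE ler_norml => /andP[+ _].
  nra.
(* Were both new components nonpositive, the complementarity row would be at
   most [- 2 x_i s_i], whereas it equals [mu' - x_i s_i]. *)
have xpos i : 0 < xof (z + d) i 0.
  rewrite ltNge; apply/negP => xneg; have := pos i.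
  have [sneg|spos] := leP (sof (z + d) i 0) 0; last first.
    by rewrite ltNge mulr_le0_ge0 // ltW.
  move: xneg sneg; rewrite xd sd => xneg sneg _.
  have := x0 i; have := s0 i; have := nE i; nra.
split=> //; split=> //.
- by move=> i; have := pos i; rewrite pmulr_rgt0.
- by rewrite -/(muz (z + d)) muE.
Qed.

End Newton.

(** * Energy of the first- and second-order displacements *)

Section Iteration.
Set Implicit Arguments.
Unset Strict Implicit.
Context {R : realType} {m n : nat}.
Variables (A : 'M[R]_(m, n)) (b : 'cV[R]_m) (c : 'cV[R]_n).
Implicit Types (z d e : iterate R m n) (nu rho theta g Q : R).

(** The factor is common to the residuals, so that [nu z0 + (1 - nu) zs] has the
    residuals of [z], and to the duality measure, so that products within
    [nu z0] compare with products within [z]. *)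
Definition shrunk z0 nu z : Prop :=
  [/\ resb A b z = nu *: resb A b z0, resc A c z = nu *: resc A c z0
    & dotv (xof z) (sof z) = nu * dotv (xof z0) (sof z0)].

(** Subtracting [e] from [z - zs], or from the first-order displacement, thus
    leaves a pair with orthogonal halves. *)
Lemma shrunk_combination z0 zs nu z : optimal A b c zs -> shrunk z0 nu z ->
  let e := nu *: (z0 - zs) in
  A *m xof e = resb A b z /\ A^T *m yof e + sof e = resc A c z.
Proof.
move=> [Ax As _ _ _] [-> -> _]; split; rewrite /resb /resc /xof /yof /sof /=.
  by rewrite -scalemxAr mulmxBr -/(xof zs) Ax.
rewrite -scalemxAr mulmxBr -scalerDr addrACA -opprD -/(yof zs) -/(sof zs).
by rewrite As.
Qed.

(** The halves of [z - zs - nu (z0 - zs)] are orthogonal.  Expanding their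
    product and dropping the nonnegative products of [zs] with [z] leaves the
    cross terms on one side, and on the other only products of [z] with itself
    or of [z0] with [z0] and [zs]; the latter are at most [rho] times the
    products within [z0].  Complementarity removes the products within [zs]. *)
Lemma cross_dot_le z0 zs nu rho z :
    positive_iterate z0 -> positive_iterate z -> optimal A b c zs ->
    lev (xof zs) (rho *: xof z0) -> lev (sof zs) (rho *: sof z0) ->
    0 <= nu -> nu <= 1 -> 1 <= rho -> shrunk z0 nu z ->
  nu * \sum_i (xof z0 i 0 * sof z i 0 + xof z i 0 * sof z0 i 0)
    <= (2 * rho + 1) * dotv (xof z) (sof z).
Proof.
move=> [x00 s00] [x0 s0] opt xs_le ss_le nu0 nu1 rho1 shr.
have [eA eB] := shrunk_combination opt shr; have [_ _ dotE] := shr.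
have [Ax As xs0 ss0 comp] := opt.
set e := nu *: (z0 - zs) in eA eB.
have orth : \sum_i (xof z i 0 - xof zs i 0 - xof e i 0) *
                   (sof z i 0 - sof zs i 0 - sof e i 0) = 0.
  have -> : \sum_i (xof z i 0 - xof zs i 0 - xof e i 0) *
                   (sof z i 0 - sof zs i 0 - sof e i 0) =
    \sum_i (xof z - xof zs - xof e) i 0 * (sof z - sof zs - sof e) i 0.
    by apply: eq_bigr => i _; rewrite !mxE.
  apply: (@null_orthogonal _ _ _ A _ _ (yof z - yof zs - yof e)).
    by rewrite !mulmxBr Ax eA /resb subrr.
  rewrite !mulmxBr addrACA [X in X + _]addrACA -!opprD As.
  by rewrite -/(resc A c z) eB subrr.
rewrite -[leLHS]addr0 -[X in _ + X]orth mulrDl mul1r {1}dotE.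
rewrite !dotvE !mulr_sumr -!big_split /=; apply: ler_sum => i _.
have := xs_le i; have := ss_le i; have := xs0 i; have := ss0 i.
have := comp i; have := x0 i; have := s0 i; have := x00 i; have := s00 i.
have -> : xof e i 0 = nu * (xof z0 i 0 - xof zs i 0) by rewrite /xof /= !mxE.
have -> : sof e i 0 = nu * (sof z0 i 0 - sof zs i 0) by rewrite /sof /= !mxE.
rewrite !mxE.
move: (xof z0 i 0) (sof z0 i 0) (xof z i 0) (sof z i 0).
move: (xof zs i 0) (sof zs i 0).
move=> u w p q x s q0 p0 sp xp uw w0 u0 wq up.
have h1 : 0 <= (1 - nu) * (u * s + x * w).
  by rewrite mulr_ge0 ?subr_ge0 ?addr_ge0 // mulr_ge0 // ltW.
have h2 : 0 <= nu * (1 - nu) * (rho * p * q - p * w).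
  rewrite mulr_ge0 // ?mulr_ge0 ?subr_ge0 //.
  by rewrite [rho * p]mulrC -mulrA ler_pM2l.
have h3 : 0 <= nu * (1 - nu) * (rho * p * q - u * q).
  by rewrite mulr_ge0 // ?mulr_ge0 ?subr_ge0 // ler_pM2r.
have h4 : 0 <= nu ^+ 2 * (p * q) * (rho - 1).
  by rewrite !mulr_ge0 ?sqr_ge0 ?subr_ge0 // ltW.
have h5 : 0 <= nu ^+ 2 * (p * q) * rho.
  have rho0 : 0 <= rho by lra.
  by rewrite !mulr_ge0 ?sqr_ge0 // ltW.
suff : 0 <= (1 - nu) * (u * s + x * w) + nu * (1 - nu) * (rho * p * q - p * w) +
    nu * (1 - nu) * (rho * p * q - u * q) + nu ^+ 2 * (p * q) * (rho - 1) +
    nu ^+ 2 * (p * q) * rho + (1 - nu) ^+ 2 * (0 - u * w) by lra.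
rewrite uw; lra.
Qed.


Lemma nbhd_half theta z i : theta <= 1 / 2 ->
  nbhd theta (xof z) (sof z) -> muz z / 2 <= xof z i 0 * sof z i 0.
Proof.
move=> th [x0 s0 near].
have mu0 : 0 <= muz z.
  rewrite /muz /mu divr_ge0 // dotvE sumr_ge0 // => j _.
  by rewrite mulr_ge0 // ltW.
have := le_trans (le_coord_norm2 _ i) near.
rewrite centeringE -/(muz z) ler_norml => /andP[+ _].
have : 0 <= muz z * (1 / 2 - theta) by rewrite mulr_ge0 ?subr_ge0.
nra.
Qed.

Lemma muz_gt0 z : (0 < n)%N -> positive_iterate z -> 0 < muz z.
Proof.
move=> n0 [x0 s0]; rewrite /muz /mu divr_gt0 ?ltr0n // dotvE.
rewrite (bigD1 (Ordinal n0)) //= ltr_pwDl ?mulr_gt0 // sumr_ge0 // => i _.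
by rewrite mulr_ge0 // ltW.
Qed.

(** Splitting [d] as [(d - e) + e] with [e = nu (z0 - zs)]: the first summand
    has orthogonal halves, and both energies are at most the square of a sum of
    absolute values that [cross_dot_le] bounds by a multiple of [n mu], divided
    by the lower bound [mu / 2] on the products [x_i s_i]. *)
Lemma predictor_energy_le theta rho z0 zs nu z d :
    positive_iterate z0 -> (0 < n)%N -> theta <= 1 / 2 ->
    nbhd theta (xof z) (sof z) -> optimal A b c zs ->
    lev (xof zs) (rho *: xof z0) -> lev (sof zs) (rho *: sof z0) ->
    0 <= nu -> nu <= 1 -> 1 <= rho -> shrunk z0 nu z ->
    newton A z (resb A b z) (resc A c z) (mulv (xof z) (sof z)) d ->
  energy z d <= (3 * (1 + rho * (2 * rho + 1)) * n%:R) ^+ 2 * muz z.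
Proof.
move=> z00 n0 th near opt xs_le ss_le nu0 nu1 rho1 shr nd.
have zp : positive_iterate z by case: near.
have [x00 s00] := z00; have [x0 s0] := zp.
have mu0 := muz_gt0 n0 zp.
have g0 : 0 < muz z / 2 by rewrite divr_gt0.
have gp i : muz z / 2 <= xof z i 0 * sof z i 0 by exact: nbhd_half near.
have dotE : dotv (xof z) (sof z) = n%:R * muz z.
  by rewrite /muz /mu mulrC divfK // pnatr_eq0 -lt0n.
have cross := cross_dot_le z00 zp opt xs_le ss_le nu0 nu1 rho1 shr.
have [eA eB] := shrunk_combination opt shr.
set e := nu *: (z0 - zs) in eA eB.
have xeE i : xof e i 0 = nu * (xof z0 i 0 - xof zs i 0) by rewrite /xof /= !mxE.
have seE i : sof e i 0 = nu * (sof z0 i 0 - sof zs i 0) by rewrite /sof /= !mxE.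
pose f i := `|sof z i 0 * xof e i 0| + `|xof z i 0 * sof e i 0|.
have rho0 : 0 <= rho by lra.
have [_ _ xs0 ss0 _] := opt.
have f0 i : 0 <= f i by rewrite addr_ge0.
have dev_le (p u : R) : 0 < p -> 0 <= u -> u <= rho * p ->
    `|nu * (p - u)| <= nu * (rho * p).
  move=> p0 u0 up; rewrite normrM (ger0_norm nu0) ler_wpM2l // ler_norml.
  have : 0 <= (rho - 1) * p by rewrite mulr_ge0 ?subr_ge0 // ltW.
  by move=> ?; apply/andP; split; lra.
have fS : \sum_i f i <= rho * (2 * rho + 1) * (n%:R * muz z).
  rewrite -dotE -mulrA; apply: le_trans (ler_wpM2l rho0 cross).
  rewrite !mulr_sumr; apply: ler_sum => i _; rewrite /f !normrM xeE seE.
  rewrite (gtr0_norm (x0 i)) (gtr0_norm (s0 i)).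
  have xsi := xs_le i; have ssi := ss_le i; rewrite !mxE in xsi ssi.
  have xs0i := xs0 i; have ss0i := ss0 i; rewrite !mxE in xs0i ss0i.
  have := ler_wpM2l (ltW (s0 i)) (dev_le _ _ (x00 i) xs0i xsi).
  have := ler_wpM2l (ltW (x0 i)) (dev_le _ _ (s00 i) ss0i ssi).
  lra.
have fS0 : 0 <= \sum_i f i by exact: sumr_ge0.
set k := rho * (2 * rho + 1) in fS *.
set N := n%:R in fS *.
have N0 : 0 <= N by exact: ler0n.
have k0 : 0 <= k by rewrite mulr_ge0 //; lra.
have energy_e : energy z e <= (\sum_i f i) ^+ 2 / (muz z / 2).
  apply: le_trans (_ : \sum_i f i ^+ 2 / (xof z i 0 * sof z i 0) <= _).
    apply: ler_sum => i _; rewrite ler_pdivlMr ?mulr_gt0 //.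
    have -> : (xof e i 0 ^+ 2 * (sof z i 0 / xof z i 0) +
        sof e i 0 ^+ 2 * (xof z i 0 / sof z i 0)) * (xof z i 0 * sof z i 0) =
      `|sof z i 0 * xof e i 0| ^+ 2 + `|xof z i 0 * sof e i 0| ^+ 2.
      rewrite !real_normK ?num_real //.
      by field; rewrite !gt_eqF.
    by rewrite sqrrD lerD2r lerDl mulrn_wge0 // mulr_ge0.
  apply: le_trans (sum_scaled_sqr_le _ g0 gp) _.
  by under eq_bigr do rewrite (ger0_norm (f0 _)).
have energy_de : energy z (d - e) <=
    (N * muz z + \sum_i f i) ^+ 2 / (muz z / 2).
  have nde : newton A z 0 0 (mulv (sof z) (xof (d - e)) +
      mulv (xof z) (sof (d - e))) (d - e).
    have [dA dB _] := nd; split=> //.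
      by rewrite /xof /= mulmxBr -/(xof d) -/(xof e) dA eA subrr.
    rewrite /yof /sof /= mulmxBr addrACA -opprD.
    by rewrite -/(yof d) -/(sof d) -/(yof e) -/(sof e) dB eB subrr.
  rewrite (energy_newton zp nde).
  apply: le_trans (sum_scaled_sqr_le _ g0 gp) _.
  rewrite ler_pM2r ?invr_gt0 //.
  rewrite ler_pXn2r ?nnegrE ?addr_ge0 ?sumr_ge0 //; last first.
    by rewrite mulr_ge0 // ltW.
  rewrite -dotE dotvE -big_split /=; apply: ler_sum => i _.
  rewrite (_ : _ i 0 = xof z i 0 * sof z i 0 -
     (sof z i 0 * xof e i 0 + xof z i 0 * sof e i 0)); last first.
    have := newtonE i nd; rewrite /xof /sof /= !mxE; lra.
  apply: le_trans (ler_normB _ _) _.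
  rewrite ger0_norm; last by rewrite mulr_ge0 // ltW.
  by rewrite lerD2l ler_normD.
have energy_split : energy z d <= 2 * (energy z (d - e) + energy z e).
  rewrite mulrDr !mulr_sumr -big_split /=; apply: ler_sum => i _.
  have -> : xof (d - e) i 0 = xof d i 0 - xof e i 0 by rewrite /xof /= !mxE.
  have -> : sof (d - e) i 0 = sof d i 0 - sof e i 0 by rewrite /sof /= !mxE.
  have h (u v w : R) : 0 < w ->
      u ^+ 2 * w <= 2 * ((u - v) ^+ 2 * w + v ^+ 2 * w).
    move=> w0; rewrite -mulrDl mulrA ler_pM2r //.
    have := sqr_ge0 (u - 2 * v); nra.
  have := h (xof d i 0) (xof e i 0) _ (divr_gt0 (s0 i) (x0 i)).
  have := h (sof d i 0) (sof e i 0) _ (divr_gt0 (x0 i) (s0 i)).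
  lra.
have fS2 : N * muz z + \sum_i f i <= (1 + k) * N * muz z by nra.
have sqr_le (s : R) : 0 <= s -> s <= (1 + k) * N * muz z ->
    s ^+ 2 / (muz z / 2) <= 2 * ((1 + k) * N) ^+ 2 * muz z.
  move=> s_ge0 s_le; rewrite ler_pdivrMr //.
  have : s ^+ 2 <= ((1 + k) * N * muz z) ^+ 2.
    by rewrite ler_pXn2r ?nnegrE // (le_trans s_ge0).
  nra.
have NM0 : 0 <= N * muz z by rewrite mulr_ge0 // ltW.
have fS1 : \sum_i f i <= N * muz z + \sum_i f i by rewrite lerDr.
have := le_trans energy_e (sqr_le _ fS0 (le_trans fS1 fS2)).
have := le_trans energy_de (sqr_le _ (addr_ge0 NM0 fS0) fS2).
have : 0 <= ((1 + k) * N) ^+ 2 * muz z by rewrite mulr_ge0 ?sqr_ge0 // ltW.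
nra.
Qed.

Lemma second_order_energy_le theta Q z d1 d2 :
    (0 < n)%N -> theta <= 1 / 2 -> nbhd theta (xof z) (sof z) ->
    newton A z 0 0 (- 2 *: mulv (xof d1) (sof d1)) d2 ->
    energy z d1 <= Q ^+ 2 * muz z ->
  energy z d2 <= 2 * Q ^+ 4 * muz z.
Proof.
move=> n0 th near nd E1.
have zp : positive_iterate z by case: near.
have mu0 := muz_gt0 n0 zp.
have g0 : 0 < muz z / 2 by rewrite divr_gt0.
have gp i : muz z / 2 <= xof z i 0 * sof z i 0 by exact: nbhd_half near.
rewrite (energy_newton zp nd); apply: le_trans (sum_scaled_sqr_le _ g0 gp) _.
rewrite ler_pdivrMr //.
have -> : 2 * Q ^+ 4 * muz z * (muz z / 2) = (Q ^+ 2 * muz z) ^+ 2 by field.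
have rhs0 : 0 <= Q ^+ 2 * muz z by rewrite mulr_ge0 ?sqr_ge0 // ltW.
rewrite ler_pXn2r ?nnegrE //; last exact: sumr_ge0.
apply: le_trans E1.
have := cross_products_le d1 d1 zp ltr01; rewrite invr1 !mul1r => h.
have {}h : \sum_i (`|xof d1 i 0 * sof d1 i 0| + `|xof d1 i 0 * sof d1 i 0|)
    <= energy z d1 by move: h; lra.
apply: le_trans h; apply: ler_sum => i _.
by rewrite !mxE normrM normrN (ger0_norm (ler0n _ 2)); lra.
Qed.

(** * Admissible angles along the arc *)

Lemma sqr_coord_le_energy z d i (E : R) : positive_iterate z ->
    muz z / 2 <= xof z i 0 * sof z i 0 ->
    energy z d <= E * muz z -> 0 < muz z ->
  xof d i 0 ^+ 2 <= 2 * E * xof z i 0 ^+ 2 /\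
  sof d i 0 ^+ 2 <= 2 * E * sof z i 0 ^+ 2.
Proof.
move=> zp mu_le E_le mu0; have [x0 s0] := zp.
have [xi si] := (x0 i, s0 i).
have : xof d i 0 ^+ 2 * (sof z i 0 / xof z i 0) +
       sof d i 0 ^+ 2 * (xof z i 0 / sof z i 0) <= E * muz z.
  apply: le_trans E_le; rewrite /energy (bigD1 i) //= lerDl sumr_ge0 // => j _.
  by have [? ?] := energy_term_ge0 d j zp; rewrite addr_ge0.
have [tx ts] := energy_term_ge0 d i zp; move=> t_le.
have bound (p q u : R) : 0 < p -> 0 < q -> muz z / 2 <= p * q ->
    u ^+ 2 * (q / p) <= E * muz z -> u ^+ 2 <= 2 * E * p ^+ 2.
  move=> p0 q0 pq u_le; have E0 : 0 <= E.
    rewrite -(pmulr_lge0 _ mu0) (le_trans _ u_le) // mulr_ge0 ?sqr_ge0 //.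
    by rewrite divr_ge0 // ltW.
  have pq0 : 0 < p * q by rewrite mulr_gt0.
  rewrite -(ler_pM2r (divr_gt0 q0 p0)) (le_trans u_le) //.
  have -> : 2 * E * p ^+ 2 * (q / p) = E * (2 * (p * q)).
    by field; rewrite gt_eqF.
  by rewrite ler_wpM2l //; lra.
split; first by apply: (bound _ _ _ xi si mu_le); lra.
by apply: (bound _ _ _ si xi); rewrite 1?[_ * xof z i 0]mulrC //; lra.
Qed.

Lemma norm_le_of_sqr (u v : R) : 0 <= v -> u ^+ 2 <= v ^+ 2 -> `|u| <= v.
Proof.
by move=> v0; rewrite -(real_normK (num_real u)) ler_pXn2r ?nnegrE.
Qed.

(** Expanding the products along the arc and using
    [sin ^ 2 = 2 (1 - cos) - (1 - cos) ^ 2] cancels the terms of lowest order in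
    the angle: besides [(1 - sin) x_i s_i] only products carrying the factors
    [(1 - cos) ^ 2] or [sin (1 - cos)] remain.  Since [1 - cos <= sin ^ 2], they
    are of order at least three in [sin * Q]. *)
Lemma arc_admissible_short theta Q z p q d1 d2 (al : R) :
    (0 < n)%N -> 0 < theta -> theta <= 1 / 2 -> 1 <= Q ->
    nbhd theta (xof z) (sof z) ->
    newton A z p q (mulv (xof z) (sof z)) d1 ->
    newton A z 0 0 (- 2 *: mulv (xof d1) (sof d1)) d2 ->
    energy z d1 <= Q ^+ 2 * muz z ->
    0 <= sin al -> 0 <= cos al -> sin al * Q <= theta / 4 ->
  arc_admissible theta (muz z) (arc_point z d1 d2 al) al.
Proof.
move=> n0 th0 th Q1 near nd1 nd2 E1 sn0 cs0 snQ.
have zp : positive_iterate z by case: near.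
have [x0 s0] := zp; have mu0 := muz_gt0 n0 zp.
have gp i : muz z / 2 <= xof z i 0 * sof z i 0 by exact: nbhd_half near.
have E2 := second_order_energy_le n0 th near nd2 E1.
(* The expansion is polynomial in [sin] and [1 - cos], hence a name for the
   latter. *)
have [B BE] : exists B, B = 1 - cos al by exists (1 - cos al).
rewrite /arc_admissible /arc_point -BE; set a := sin al in sn0 snQ *.
have B0 : 0 <= B by rewrite BE subr_ge0 cos_le1.
have Ba : B <= a ^+ 2.
  have := cos2Dsin2 al; rewrite -/a.
  have : cos al ^+ 2 <= cos al by rewrite expr2 ler_piMl // cos_le1.
  by move: BE; lra.
set q0 := a * Q in snQ.
have aq : a <= q0 by rewrite ler_peMr.
have q00 : 0 <= q0 by exact: le_trans aq.
have q8 : q0 <= 1 / 8 by lra.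
have Q0 : 0 <= Q by lra.
have wq : B * Q ^+ 2 <= q0 ^+ 2 by rewrite exprMn ler_wpM2r // sqr_ge0.
have w0 : 0 <= B * Q ^+ 2 by rewrite mulr_ge0 // sqr_ge0.
have BQ : B * Q <= B * Q ^+ 2 by rewrite ler_wpM2l // expr2 ler_peMr.
have BQ0 : 0 <= B * Q by rewrite mulr_ge0.
have q64 : q0 ^+ 2 <= 1 / 64 by nra.
have xE i : xof (z - a *: d1 + B *: d2) i 0 =
  xof z i 0 - a * xof d1 i 0 + B * xof d2 i 0 by rewrite /xof /= !mxE.
have sE i : sof (z - a *: d1 + B *: d2) i 0 =
  sof z i 0 - a * sof d1 i 0 + B * sof d2 i 0 by rewrite /sof /= !mxE.
split.
  have pos (u v w : R) : 0 < u -> v ^+ 2 <= 2 * Q ^+ 2 * u ^+ 2 ->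
      w ^+ 2 <= 2 * (2 * Q ^+ 4) * u ^+ 2 -> 0 < u - a * v + B * w.
    move=> u0 v_le w_le; have u2 := sqr_ge0 u.
    have : `|a * v| <= u / 4.
      apply: norm_le_of_sqr; first by rewrite divr_ge0 // ltW.
      rewrite exprMn (le_trans (ler_wpM2l (sqr_ge0 a) v_le)) //.
      have -> : a ^+ 2 * (2 * Q ^+ 2 * u ^+ 2) = 2 * q0 ^+ 2 * u ^+ 2.
        by rewrite /q0; ring.
      nra.
    have : `|B * w| <= u / 4.
      apply: norm_le_of_sqr; first by rewrite divr_ge0 // ltW.
      rewrite exprMn (le_trans (ler_wpM2l (sqr_ge0 B) w_le)) //.
      have -> : B ^+ 2 * (2 * (2 * Q ^+ 4) * u ^+ 2) =
          4 * (B * Q ^+ 2) ^+ 2 * u ^+ 2 by ring.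
      have : (B * Q ^+ 2) ^+ 2 <= 1 / 64 by nra.
      nra.
    by rewrite !ler_norml => /andP[? ?] /andP[? ?]; lra.
  split=> i; rewrite ?xE ?sE.
    have [h1 _] := sqr_coord_le_energy zp (gp i) E1 mu0.
    by have [h2 _] := sqr_coord_le_energy zp (gp i) E2 mu0; exact: pos.
  have [_ h1] := sqr_coord_le_energy zp (gp i) E1 mu0.
  by have [_ h2] := sqr_coord_le_energy zp (gp i) E2 mu0; exact: pos.
pose v : 'cV[R]_n := \col_i (- B ^+ 2 * (xof d1 i 0 * sof d1 i 0)
  - a * B * (xof d1 i 0 * sof d2 i 0 + xof d2 i 0 * sof d1 i 0)
  + B ^+ 2 * (xof d2 i 0 * sof d2 i 0)).
have aB : a ^+ 2 = 2 * B - B ^+ 2.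
  by have := cos2Dsin2 al; rewrite -/a; move: BE; nra.
set za := z - a *: d1 + B *: d2 in xE sE *.
have -> : mulv (xof za) (sof za) - ((1 - a) * muz z) *: onev =
    (1 - a) *: (mulv (xof z) (sof z) - muz z *: onev) + v.
  have addZE (w y : 'cV[R]_n) i : ((1 - a) *: w + y) i 0 =
      (1 - a) * w i 0 + y i 0.
    by rewrite !mxE.
  apply/colP => i; rewrite centeringE xE sE addZE centeringE.
  have e1 := newtonE i nd1; have e2 := newtonE i nd2; rewrite !mxE in e1 e2 *.
  move: e1 e2 => /(congr1 ( *%R a)) e1 /(congr1 ( *%R B)) e2.
  have e3 := congr1 ( *%R^~ (xof d1 i 0 * sof d1 i 0)) aB.
  lra.
apply: le_trans (norm2D_l1 _ _) _.
have a1 : a <= 1 / 8 by lra.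
rewrite norm2Z; last by lra.
have [_ _ near'] := near; rewrite -/(muz z) in near'.
have : (1 - a) * norm2 (mulv (xof z) (sof z) - muz z *: onev) <=
  (1 - a) * (theta * muz z) by rewrite ler_wpM2l //; lra.
suff : \sum_i `|v i 0| <= theta * (1 - a) * muz z by lra.
have v_le : \sum_i `|v i 0| <=
    B ^+ 2 / 2 *
      \sum_i (`|xof d1 i 0 * sof d1 i 0| + `|xof d1 i 0 * sof d1 i 0|)
  + a * B *
      \sum_i (`|xof d1 i 0 * sof d2 i 0| + `|xof d2 i 0 * sof d1 i 0|)
  + B ^+ 2 / 2 *
      \sum_i (`|xof d2 i 0 * sof d2 i 0| + `|xof d2 i 0 * sof d2 i 0|).
  rewrite !mulr_sumr -!big_split /=; apply: ler_sum => i _; rewrite mxE.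
  apply: le_trans (ler_normD _ _) _; apply: lerD; last first.
    by rewrite normrM (ger0_norm (sqr_ge0 B)); lra.
  apply: le_trans (ler_normB _ _) _; apply: lerD.
    by rewrite mulNr normrN normrM (ger0_norm (sqr_ge0 B)); lra.
  rewrite normrM (ger0_norm (mulr_ge0 sn0 B0)).
  by rewrite ler_wpM2l ?mulr_ge0 // ler_normD.
have c11 := cross_products_le d1 d1 zp ltr01.
have c22 := cross_products_le d2 d2 zp ltr01.
have Qpos : 0 < Q by lra.
(* The weight [Q] equalizes the two energies, of orders [Q ^ 2] and [Q ^ 4]. *)
have c12 := cross_products_le d1 d2 zp Qpos.
rewrite invr1 !mul1r in c11 c22.
have {}c11 := ler_wpM2l (divr_ge0 (sqr_ge0 B) (ler0n R 2))
   (le_trans c11 (_ : _ <= Q ^+ 2 * muz z)).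
have {}c22 := ler_wpM2l (divr_ge0 (sqr_ge0 B) (ler0n R 2))
   (le_trans c22 (_ : _ <= 2 * Q ^+ 4 * muz z)).
have QE2 : Q^-1 * energy z d2 <= 2 * Q ^+ 3 * muz z.
  rewrite mulrC ler_pdivrMr // (le_trans E2) // le_eqVlt.
  by apply/orP; left; apply/eqP; ring.
have QE1 : Q * energy z d1 <= Q ^+ 3 * muz z.
  apply: le_trans (ler_wpM2l Q0 E1) _; rewrite le_eqVlt.
  by apply/orP; left; apply/eqP; ring.
have {}c12 := ler_wpM2l (mulr_ge0 sn0 B0)
   (le_trans c12 (_ : _ <= 3 / 2 * Q ^+ 3 * muz z)).
apply: le_trans v_le _.
apply: le_trans (lerD (lerD (c11 _) (c12 _)) (c22 _)) _; [lra|lra|lra|].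
have -> : B ^+ 2 / 2 * (Q ^+ 2 * muz z) + a * B * (3 / 2 * Q ^+ 3 * muz z) +
    B ^+ 2 / 2 * (2 * Q ^+ 4 * muz z) =
  ((B * Q) ^+ 2 / 2 + 3 / 2 * q0 * (B * Q ^+ 2) + (B * Q ^+ 2) ^+ 2) * muz z.
  by rewrite /q0; field.
rewrite ler_pM2r //.
have : (B * Q) ^+ 2 <= (B * Q ^+ 2) ^+ 2 by rewrite ler_pXn2r.
have : (B * Q ^+ 2) ^+ 2 <= q0 ^+ 2 / 64 by nra.
have : q0 * (B * Q ^+ 2) <= q0 / 64 by nra.
have : theta * (1 - a) >= theta / 2 by nra.
nra.
Qed.

(** The angle [asin (theta / (4 * Q))] is a valid step, since all angles below
    it have a smaller sine; the largest valid step is not smaller. *)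
Lemma largest_arc_step_sin_ge theta Q z p q d1 d2 (al : R) :
    (0 < n)%N -> 0 < theta -> theta <= 1 / 2 -> 1 <= Q ->
    nbhd theta (xof z) (sof z) ->
    newton A z p q (mulv (xof z) (sof z)) d1 ->
    newton A z 0 0 (- 2 *: mulv (xof d1) (sof d1)) d2 ->
    energy z d1 <= Q ^+ 2 * muz z ->
    largest_arc_step theta z d1 d2 al ->
  theta / (4 * Q) <= sin al.
Proof.
move=> n0 th0 th Q1 near nd1 nd2 E1 [[al0 al1 _] al_max].
have Q0 : 0 < Q by lra.
set t := theta / (4 * Q).
have tQ : t * Q = theta / 4 by rewrite /t; field; rewrite gt_eqF.
have t0 : 0 < t by rewrite divr_gt0 // mulr_gt0.
have t1 : t <= 1 by nra.
have tin : t \in `[-1, 1] by rewrite in_itv /=; apply/andP; split; lra.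
have tin' : -1 <= t <= 1 by apply/andP; split; lra.
have pi0 := pi_gt0 R.
have asin_in : asin t \in `[- (pi / 2), pi / 2].
  by rewrite in_itv /= asin_geNpi2 // asin_lepi2.
have in_quadrant (u : R) : 0 <= u -> u <= pi / 2 -> u \in `[- (pi / 2), pi / 2].
  move=> u0 u1; rewrite in_itv /= u1 andbT (le_trans _ u0) //.
  by rewrite oppr_le0 divr_ge0 // ltW.
have asin0 : 0 < asin t.
  rewrite -ltr_sin // ?sin0 ?asinK //.
  by apply: in_quadrant => //; rewrite divr_ge0 // ltW.
have sin_le (u v : R) : 0 <= u -> u <= v -> v <= pi / 2 -> sin u <= sin v.
  move=> u0 uv v1; have v0 := le_trans u0 uv; have u1 := le_trans uv v1.
  by rewrite leNgt ltr_sin ?in_quadrant // -leNgt.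
rewrite -[t](asinK tin); apply: (sin_le) => //; first exact: ltW.
apply: al_max; split=> //; first by rewrite asin_lepi2.
move=> u u0 u_le.
have u1 : u <= pi / 2 by rewrite (le_trans u_le) // asin_lepi2.
apply: (arc_admissible_short n0 th0 th Q1 near nd1 nd2 E1).
- by rewrite -(@sin0 R) sin_le // ltW.
- have := in_quadrant u (ltW u0) u1; rewrite in_itv /=;
  exact: cos_ge0_pihalf.
- rewrite -tQ ler_pM2r // -[leRHS](asinK tin) sin_le ?asin_lepi2 //.
  exact: ltW.
Qed.

(** * One iteration and the whole run *)

Lemma arc_iteration_outcome theta rho z0 zs nu z z' (al : R) :
    positive_iterate z0 -> (0 < n)%N ->
    0 < theta -> 2 * theta < 1 -> 2 * theta ^+ 2 <= (1 - 2 * theta) ^+ 2 ->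
    optimal A b c zs ->
    lev (xof zs) (rho *: xof z0) -> lev (sof zs) (rho *: sof z0) ->
    0 <= nu -> nu <= 1 -> 1 <= rho ->
    nbhd theta (xof z) (sof z) -> shrunk z0 nu z ->
    arc_iteration A b c theta z al z' -> al < pi / 2 ->
  [/\ theta / (4 * (3 * (1 + rho * (2 * rho + 1)) * n%:R)) <= sin al,
      sin al < 1,
      nbhd theta (xof z') (sof z') & shrunk z0 ((1 - sin al) * nu) z'].
Proof.
move=> z00 n0 th0 th1 th2 opt xs_le ss_le nu0 nu1 rho1 near shr.
move=> [d1 [d2 [dz /= [nd1 nd2 step ndz ->]]]] al_lt.
have zp : positive_iterate z by case: near.
have mu0 := muz_gt0 n0 zp.
have th : theta <= 1 / 2 by lra.
have := predictor_energy_le z00 n0 th near opt xs_le ss_le nu0 nu1 rho1 shr nd1.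
set Q := _ * n%:R => E1.
have Q1 : 1 <= Q.
  have : 1 <= n%:R :> R by rewrite ler1n.
  have : 3 <= 3 * (1 + rho * (2 * rho + 1)) by nra.
  by rewrite /Q; nra.
have sin_ge := largest_arc_step_sin_ge n0 th0 th Q1 near nd1 nd2 E1 step.
have [[al0 al1 /(_ al al0 (lexx _)) [zap zan]] _] := step.
have sin_lt : sin al < 1.
  have pi0 := pi_gt0 R.
  by rewrite -sin_pihalf ltr_sin // in_itv /= ?al1 ?lexx ?andbT; lra.
set a := sin al in sin_ge sin_lt zan *.
have mu'0 : 0 < (1 - a) * muz z by rewrite mulr_gt0 // subr_gt0.
move: zan; rewrite -mulrA => zan.
have [near' muE] := corrector_nbhd th0 th1 th2 n0 mu'0 zap zan ndz.
split=> //; have [rb rc dE] := shr.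
have [A1 A1' _] := nd1; have [A2 A2' _] := nd2; have [Az Az' _] := ndz.
set za := arc_point z d1 d2 al in near' muE *.
have nz : n%:R != 0 :> R by rewrite pnatr_eq0 -lt0n.
split.
- rewrite -scalerA -rb scalerBl scale1r -[in a *: _]A1 /resb.
  rewrite (_ : xof (za + dz) =
    xof z - a *: xof d1 + (1 - cos al) *: xof d2 + xof dz) //.
  by rewrite !mulmxDr mulmxN -!scalemxAr A2 Az scaler0 !addr0 addrAC.
- rewrite -scalerA -rc scalerBl scale1r -[in a *: _]A1' /resc.
  rewrite (_ : yof (za + dz) =
    yof z - a *: yof d1 + (1 - cos al) *: yof d2 + yof dz) //.
  rewrite (_ : sof (za + dz) =
    sof z - a *: sof d1 + (1 - cos al) *: sof d2 + sof dz) //.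
  rewrite !mulmxDr mulmxN -!scalemxAr addrACA Az' addr0 addrACA -scalerDr A2'.
  rewrite scaler0 addr0 addrACA -opprD -scalerDr; exact: addrAC.
- rewrite -mulrA -dE; move: muE; rewrite /muz /mu => /(congr1 ( *%R^~ n%:R)).
  by rewrite mulrA !divfK.
Qed.

Lemma performed_invariant theta rho eps zs (z : nat -> iterate R m n)
    (al : nat -> R) :
    (0 < n)%N ->
    0 < theta -> 2 * theta < 1 -> 2 * theta ^+ 2 <= (1 - 2 * theta) ^+ 2 ->
    1 <= rho -> nbhd theta (xof (z 0%N)) (sof (z 0%N)) ->
    optimal A b c zs ->
    lev (xof zs) (rho *: xof (z 0%N)) -> lev (sof zs) (rho *: sof (z 0%N)) ->
    arc_search_run A b c theta eps z al ->
    (forall k, performed A b c eps z k -> al k < pi / 2) ->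
  forall k, (forall j, (j < k)%N -> ~ stop A b c eps (z j)) ->
  exists nu : R,
    [/\ 0 <= nu,
        nu <=
          expR (- (theta / (4 * (3 * (1 + rho * (2 * rho + 1)) * n%:R)))) ^+ k,
        nbhd theta (xof (z k)) (sof (z k)) & shrunk (z 0%N) nu (z k)].
Proof.
move=> n0 th0 th1 th2 rho1 near0 opt xs_le ss_le run al_lt.
set u := theta / _.
have u0 : 0 <= u.
  have k0 : 0 <= 1 + rho * (2 * rho + 1) by nra.
  by rewrite divr_ge0 ?(ltW th0) // !mulr_ge0.
have z00 : positive_iterate (z 0%N) by case: near0.
elim=> [|k IH] perf.
  by exists 1; split=> //; split; rewrite ?scale1r ?mul1r.
have [nu [nu0 nu_le near shr]] := IH (fun j jk => perf j (ltnW jk)).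
have nu1 : nu <= 1.
  rewrite (le_trans nu_le) // exprn_ile1 ?expR_ge0 //.
  by rewrite -expR0 ler_expR oppr_le0.
have perfk : performed A b c eps z k by move=> j jk; exact: perf.
have [sin_ge sin_lt near' shr'] := arc_iteration_outcome z00 n0 th0 th1 th2
  opt xs_le ss_le nu0 nu1 rho1 near shr (run k perfk) (al_lt k perfk).
exists ((1 - sin (al k)) * nu); split=> //.
  by rewrite mulr_ge0 // subr_ge0 ltW.
rewrite exprS; apply: ler_pM => //.
by apply: le_trans (expR_ge1Dx _); rewrite lerD2l lerN2.
Qed.

Lemma shrunk_stop eps nu z0 z : (0 < n)%N -> positive_iterate z -> 0 <= nu ->
    shrunk z0 nu z ->
    nu * dotv (xof z0) (sof z0) <= eps -> nu * norm2 (resb A b z0) <= eps ->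
    nu * norm2 (resc A c z0) <= eps ->
  stop A b c eps z.
Proof.
move=> n0 zp nu0 [rb rc dE] d_le rb_le rc_le; split=> //.
- apply: le_trans d_le; rewrite -dE /muz /mu ler_pdivrMr ?ltr0n //.
  rewrite ler_peMr ?ler1n // dotvE sumr_ge0 // => i _.
  by have [x0 s0] := zp; rewrite mulr_ge0 // ltW.
- by rewrite rb norm2Z.
- by rewrite rc norm2Z.
Qed.

(** The case [r <= 0], where the logarithm is [-oo], is that of a residual
    vanishing at the starting point. *)
Lemma lne_le_expR (r l : R) : (lne r%:E <= l%:E)%E -> r <= expR l.
Proof.
move=> h; have [r0|r0] := leP r 0; first by rewrite (le_trans r0) // expR_ge0.
by rewrite -[leLHS]lnK ?posrE // ler_expR -lee_fin -lne_EFin.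
Qed.

(** The maximum with [0] is a finite number even if [L] is [-oo], so taking
    [fine] loses nothing. *)
Lemma logL_bounds eps z0 (l : R) : 0 < eps ->
    l = fine (maxe (logL A b c eps z0) 0%E) ->
  [/\ 0 <= l, dotv (xof z0) (sof z0) <= eps * expR l,
      norm2 (resb A b z0) <= eps * expR l &
      norm2 (resc A c z0) <= eps * expR l].
Proof.
move=> eps0 lE.
have lne_lty (r : R) : (lne r%:E < +oo)%E.
  by have [r0|r0] := leP r 0; [rewrite le0_lneNy|rewrite lne_EFin ?ltry].
have lfin : (maxe (logL A b c eps z0) 0 = l%:E)%E.
  rewrite lE fineK // ge0_fin_numE ?le_max ?lexx ?orbT //.
  by rewrite /logL !gt_max !lne_lty ltry.
have : (maxe (logL A b c eps z0) 0 <= l%:E)%E by rewrite lfin.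
rewrite /logL !ge_max lee_fin => /andP[/and3P[hd hb hc] l0].
by split=> //; rewrite mulrC -ler_pdivrMr //; exact: lne_le_expR.
Qed.

(** The estimates of a step divide by [n].  Without columns the value of [A x]
    does not depend on [x], so that feasibility of the optimal solution makes the
    primal residual vanish, and the other tested quantities are sums over an
    empty set of indices. *)
Lemma stop_of_no_columns eps z : n = 0%N -> 0 <= eps ->
  (exists zs, optimal A b c zs) -> stop A b c eps z.
Proof.
move=> n0 eps0 [zs [Ax _ _ _ _]].
have noI (i : 'I_n) : False by case: i => i; rewrite n0.
have xE : xof z = xof zs by apply/colP => i; case: (noI i).
split.
- by rewrite /muz /mu dotvE big1 ?mul0r // => i; case: (noI i).
- rewrite /resb xE Ax subrr norm2_le // dotvE big1 ?sqr_ge0 // => i _.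
  by rewrite mxE mul0r.
- by rewrite norm2_le // dotvE big1 ?sqr_ge0 // => i; case: (noI i).
- by split=> i; case: (noI i).
Qed.

End Iteration.

Theorem theorem4p1 (R : realType) (theta rho : R)
    (theta_gt0 : 0 < theta) (theta_le : theta <= 1 / (2 + Num.sqrt 2))
    (rho_ge1 : 1 <= rho) :
  exists K : R, 0 < K /\
    forall (m n : nat) (A : 'M[R]_(m, n)) (b : 'cV[R]_m) (c : 'cV[R]_n)
           (x0 : 'cV[R]_n) (y0 : 'cV[R]_m) (s0 : 'cV[R]_n),
      nbhd theta x0 s0 ->
      (exists zs : iterate R m n,
         [/\ optimal A b c zs, lev (xof zs) (rho *: x0)
           & lev (sof zs) (rho *: s0)]) ->
    forall (eps : R), 0 < eps ->
    forall (z : nat -> iterate R m n) (alpha : nat -> R),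
      z 0%N = (x0, y0, s0) ->
      arc_search_run A b c theta eps z alpha ->
      (forall k, performed A b c eps z k -> alpha k < pi / 2) ->
    exists k : nat,
      terminates_at A b c eps z k /\
      (k%:Z <= Num.ceil (K * n%:R * fine (maxe (logL A b c eps (x0, y0, s0)) 0%E)))%R.
Proof.
have sq0 : 0 < Num.sqrt 2 :> R by rewrite sqrtr_gt0.
have sq2 : Num.sqrt 2 ^+ 2 = 2 :> R by rewrite sqr_sqrtr.
have {theta_le} thsq : theta * Num.sqrt 2 <= 1 - 2 * theta.
  by move: theta_le; rewrite ler_pdivlMr ?addr_gt0 //; lra.
have th0 : 0 < theta * Num.sqrt 2 by rewrite mulr_gt0.
have th1 : 2 * theta < 1 by lra.
have th2 : 2 * theta ^+ 2 <= (1 - 2 * theta) ^+ 2.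
  by rewrite -{1}sq2 mulrC -exprMn ler_pXn2r // nnegrE ?subr_ge0 ltW.
set kappa := 1 + rho * (2 * rho + 1).
have kappa0 : 0 < kappa by rewrite /kappa; nra.
have K0 : 0 < 12 * kappa / theta by rewrite divr_gt0 // mulr_gt0.
(* The reciprocal of [n] times the lower bound [theta / (4 Q)] on the sines,
   with [Q = 3 kappa n]. *)
exists (12 * kappa / theta); split=> //.
move=> m n A b c x0 y0 s0 near0 [zs [opt xs_le ss_le]].
move=> eps eps0 z al z0E run al_lt.
set l := fine _; have lE : l = fine (maxe (logL A b c eps (z 0%N)) 0%E).
  by rewrite z0E.
set K := 12 * kappa / theta in K0 *.
have [l0 dl bl cl] := logL_bounds eps0 lE.
have ceil0 : 0 <= Num.ceil (K * n%:R * l).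
  rewrite ceil_ge0 (@lt_le_trans _ _ 0) ?ltrN10 //.
  exact: mulr_ge0 (mulr_ge0 (ltW K0) (ler0n _ _)) l0.
suff [k [k_le k_stop]] : exists k : nat,
    (k%:Z <= Num.ceil (K * n%:R * l))%R /\ stop A b c eps (z k).
  have ex : exists j, `[< stop A b c eps (z j) >] by exists k; exact/asboolP.
  have [j /asboolP j_stop j_min] := ex_minnP ex.
  exists j; split; last first.
    by rewrite (le_trans _ k_le) // lez_nat j_min //; exact/asboolP.
  split=> // i ij i_stop; suff : (j <= i)%N by rewrite leqNgt ij.
  by apply: j_min; exact/asboolP.
have [n0|n0] := posnP n.
  exists 0%N; split=> //; apply: stop_of_no_columns n0 (ltW eps0) _.
  by exists zs.
have [N NE] : exists N : nat, N%:Z = Num.ceil (K * n%:R * l).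
  by exists `|Num.ceil (K * n%:R * l)|%N; rewrite gez0_abs.
apply: contrapT => no_stop.
have perf j : (j <= N)%N -> ~ stop A b c eps (z j).
  by move=> jN j_stop; apply: no_stop; exists j; rewrite -NE lez_nat.
have near0' : nbhd theta (xof (z 0%N)) (sof (z 0%N)) by rewrite z0E.
have [nu [nu0 nu_le [xp sp _] shr]] : exists nu : R,
    [/\ 0 <= nu, nu <= expR (- (theta / (4 * (3 * kappa * n%:R)))) ^+ N,
        nbhd theta (xof (z N)) (sof (z N)) & shrunk A b c (z 0%N) nu (z N)].
  apply: (performed_invariant n0 theta_gt0 th1 th2 rho_ge1 near0' opt _ _ run
    al_lt).
  - by rewrite z0E.
  - by rewrite z0E.
  - by move=> j jN; apply: perf; exact: ltnW.
have nu_l : nu <= expR (- l).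
  apply: le_trans nu_le _; rewrite -expRM_natl ler_expR mulrN lerN2.
  have : K * n%:R * l <= N%:R.
    by rewrite (le_trans (Num.Theory.ceil_ge _)) // -NE -pmulrn.
  have nR : 0 < n%:R :> R by rewrite ltr0n.
  have -> : N%:R * (theta / (4 * (3 * kappa * n%:R))) = N%:R / (K * n%:R).
    by rewrite /K; field; rewrite !gt_eqF.
  by rewrite ler_pdivlMr ?(mulr_gt0 K0 nR) // mulrC.
have nu_eps : nu * (eps * expR l) <= eps.
  rewrite mulrCA ler_piMr ?(ltW eps0) // -ler_pdivlMr ?expR_gt0 //.
  by rewrite div1r -expRN.
by apply: (perf N (leqnn _)); apply: (shrunk_stop n0 (conj xp sp) nu0 shr);
  apply: le_trans nu_eps; exact: ler_wpM2l.
Qed.
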